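(* Consider the two-level quantum system with Markovian (dissipative) evolution $L(\rho)=D_{J_+}(\rho)+D_{J_-}(\rho)$, where $D_J(\rho)=J\rho J^*-\frac12(J^*J\rho+\rho J^*J)$, $J_+=\begin{pmatrix}0&1\\0&0\end{pmatrix}$, $J_-=\begin{pmatrix}0&0\\1&0\end{pmatrix}$, whose associated vector field on the set of states $\mathcal{D}$ is $Z_L=-x_1\frac{\partial}{\partial x_1}-x_2\frac{\partial}{\partial x_2}-2x_3\frac{\partial}{\partial x_3}$, with flow $\Phi^L_t$. For the families of tensor fields $\Lambda_{\mathcal{D},t}=\Phi^L_{t*}\Lambda_{\mathcal{D}}$ and $R_{\mathcal{D},t}=\Phi^L_{t*}R_{\mathcal{D}}$, given by $$\Lambda_{\mathcal{D},t}=x_3\frac{\partial}{\partial x_1}\wedge\frac{\partial}{\partial x_2}+e^{-2t}x_1\frac{\partial}{\partial x_2}\wedge\frac{\partial}{\partial x_3}+e^{-2t}x_2\frac{\partial}{\partial x_3}\wedge\frac{\partial}{\partial x_1},$$ $$R_{\mathcal{D},t}=e^{-2t}\left(\frac{\partial}{\partial x_1}\otimes\frac{\partial}{\partial x_1}+\frac{\partial}{\partial x_2}\otimes\frac{\partial}{\partial x_2}\right)+e^{-4t}\frac{\partial}{\partial x_3}\otimes\frac{\partial}{\partial x_3}-\sum_{j,k=1}^3x_jx_k\frac{\partial}{\partial x_j}\otimes\frac{\partial}{\partial x_k},$$ the asymptotic limits as $t\to\infty$ exist and are $$\Lambda_{\mathcal{D},\infty}=x_3\frac{\partial}{\partial x_1}\wedge\frac{\partial}{\partial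 x_2},\qquad R_{\mathcal{D},\infty}=-\sum_{j,k=1}^3x_jx_k\frac{\partial}{\partial x_j}\otimes\frac{\partial}{\partial x_k}.$$ The products $\{f,g\}_\infty=\Lambda_{\mathcal{D},\infty}(\mathrm{d}f,\mathrm{d}g)$ and $(f,g)_\infty=R_{\mathcal{D},\infty}(\mathrm{d}f,\mathrm{d}g)+fg$ of smooth functions on $\mathcal{D}$ are respectively a Poisson bracket and a symmetric product.
   Context: States of the two-level system are the density matrices $\rho=\frac12(I+x_1\sigma_1+x_2\sigma_2+x_3\sigma_3)$, with $\sigma_j$ the Pauli matrices and $x_1^2+x_2^2+x_3^2\le1$; thus $\mathcal{D}$ is the closed unit ball of $\mathbb{R}^3$ with coordinates $(x_1,x_2,x_3)$. The initial tensor fields are $$\Lambda_{\mathcal{D}}=\tfrac12\sum_{j,k,l}\epsilon_{jkl}x_l\frac{\partial}{\partial x_j}\wedge\frac{\partial}{\partial x_k},\qquad R_{\mathcal{D}}=\sum_j\frac{\partial}{\partial x_j}\otimes\frac{\partial}{\partial x_j}-\sum_{j,k}x_jx_k\frac{\partial}{\partial x_j}\otimes\frac{\partial}{\partial x_k},$$ where $v\wedge w=v\otimes w-w\otimes v$. The push-forward by the flow is taken on $\mathbb{R}^3$ and satisfies $\Phi^L_{t*}=e^{-t\mathcal{L}_{Z_L}}$, where $\mathcal{L}$ is the Lie derivative. Limits are pointwise (coefficientwise). *)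

(* Defs.v *)
From HB Require Import structures.
From mathcomp Require Import all_boot all_order all_algebra.
From mathcomp Require Import all_classical all_reals all_analysis.
From mathcomp Require Import complex.

Set Implicit Arguments.
Unset Strict Implicit.
Unset Printing Implicit Defensive.

Import Order.TTheory GRing.Theory Num.Theory.
Import numFieldNormedType.Exports.

Local Open Scope classical_set_scope.
Local Open Scope ring_scope.
Local Open Scope complex_scope.

(* Coordinates are numbered from 0: x_1, x_2, x_3 are the entries x 0 0,       *)
(* x 0 1, x 0 2 for a row vector x : 'rV[R]_3.                                *)

Section TwoLevel.
Variable R : realType.

Definition mx22 (a b c d : R[i]) : 'M[R[i]]_2 :=
  \matrix_(i, j) if i == 0 then (if j == 0 then a else b)
                 else (if j == 0 then c else d).

Definition pauli (j : 'I_3) : 'M[R[i]]_2 :=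
  if j == 0 then mx22 0 1 1 0
  else if j == 1 then mx22 0 (- 'i) 'i 0
  else mx22 1 0 0 (- 1).

Definition bloch (x : 'rV[R]_3) : 'M[R[i]]_2 :=
  2^-1 *: (1%:M + \sum_j (x 0 j)%:C *: pauli j).

(* The differential of the affine map [bloch]. *)
Definition dbloch (v : 'rV[R]_3) : 'M[R[i]]_2 :=
  2^-1 *: \sum_j (v 0 j)%:C *: pauli j.

(* Euclidean unit ball; the library's norm on 'rV is the maximum norm. *)
Definition states : set 'rV[R]_3 := [set x | \sum_j x 0 j ^+ 2 <= 1].

Definition adjmx n (A : 'M[R[i]]_n) : 'M[R[i]]_n := map_mx Num.conj A^T.

Definition dissipator (J rho : 'M[R[i]]_2) : 'M[R[i]]_2 :=
  J *m rho *m adjmx J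
  - 2^-1 *: (adjmx J *m J *m rho + rho *m (adjmx J *m J)).

Definition Jplus : 'M[R[i]]_2 := mx22 0 1 0 0.
Definition Jminus : 'M[R[i]]_2 := mx22 0 0 1 0.

Definition generator (rho : 'M[R[i]]_2) : 'M[R[i]]_2 :=
  dissipator Jplus rho + dissipator Jminus rho.

(* The linear evolution rho' = L rho reads x' = Z x in the coordinates x.     *)
Definition associated_field (L : 'M[R[i]]_2 -> 'M[R[i]]_2)
    (Z : 'rV[R]_3 -> 'rV[R]_3) : Prop :=
  forall x, L (bloch x) = dbloch (Z x).

End TwoLevel.

Arguments states : clear implicits.

Section Tensors.
Variable R : realType.

Definition partial (j : 'I_3) : 'rV[R]_3 := delta_mx 0 j.

(* The tensor \sum_(j, k) T j k d_j (x) d_k is represented by its matrix T.   *)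
Definition tens (v w : 'rV[R]_3) : 'M[R]_3 := v^T *m w.
Definition wedge (v w : 'rV[R]_3) : 'M[R]_3 := tens v w - tens w v.

(* Addition in 'I_3 is modulo 3. *)
Definition levi_civita (j k l : 'I_3) : R :=
  if (k == j + 1) && (l == j + 2) then 1
  else if (k == j + 2) && (l == j + 1) then -1
  else 0.

Definition Lambda0 (x : 'rV[R]_3) : 'M[R]_3 :=
  2^-1 *: \sum_j \sum_k \sum_l
    (levi_civita j k l * x 0 l) *: wedge (partial j) (partial k).

Definition R0 (x : 'rV[R]_3) : 'M[R]_3 :=
  \sum_j tens (partial j) (partial j)
  - \sum_j \sum_k (x 0 j * x 0 k) *: tens (partial j) (partial k).

Definition ZL (x : 'rV[R]_3) : 'rV[R]_3 :=
  - x 0 0 *: partial 0 - x 0 1 *: partial 1 - (2 * x 0 2) *: partial 2.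

Definition is_flow (Z : 'rV[R]_3 -> 'rV[R]_3) (Phi : R -> 'rV[R]_3 -> 'rV[R]_3)
    : Prop :=
  (forall x, Phi 0 x = x) /\
  (forall t x, is_derive (t : R) (1 : R) (Phi ^~ x) (Z (Phi t x))).

(* Push-forward by a diffeomorphism phi with inverse psi. With row vectors,   *)
(* v (x) w at psi y is sent to (v *m 'J) (x) (w *m 'J) at y.                  *)
Definition pushforward (phi psi : 'rV[R]_3 -> 'rV[R]_3)
    (T : 'rV[R]_3 -> 'M[R]_3) (y : 'rV[R]_3) : 'M[R]_3 :=
  ('J phi (psi y))^T *m T (psi y) *m 'J phi (psi y).

Definition flow_push (Phi : R -> 'rV[R]_3 -> 'rV[R]_3) (t : R)
    (T : 'rV[R]_3 -> 'M[R]_3) : 'rV[R]_3 -> 'M[R]_3 :=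
  pushforward (Phi t) (Phi (- t)) T.

Definition Lambda_t (t : R) (x : 'rV[R]_3) : 'M[R]_3 :=
  x 0 2 *: wedge (partial 0) (partial 1)
  + (expR (- 2 * t) * x 0 0) *: wedge (partial 1) (partial 2)
  + (expR (- 2 * t) * x 0 1) *: wedge (partial 2) (partial 0).

Definition R_t (t : R) (x : 'rV[R]_3) : 'M[R]_3 :=
  expR (- 2 * t) *:
    (tens (partial 0) (partial 0) + tens (partial 1) (partial 1))
  + expR (- 4 * t) *: tens (partial 2) (partial 2)
  - \sum_j \sum_k (x 0 j * x 0 k) *: tens (partial j) (partial k).

Definition Lambda_oo (x : 'rV[R]_3) : 'M[R]_3 :=
  x 0 2 *: wedge (partial 0) (partial 1).

Definition R_oo (x : 'rV[R]_3) : 'M[R]_3 :=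
  - \sum_j \sum_k (x 0 j * x 0 k) *: tens (partial j) (partial k).

End Tensors.

Section Smooth.
Variable R : realType.

Fixpoint Ck (k : nat) (U : set 'rV[R]_3) (F : 'rV[R]_3 -> R) : Prop :=
  if k is k'.+1 then
    (forall x, U x -> differentiable F x) /\
    (forall j, Ck k' U ('D_(partial R j) F))
  else forall x, U x -> {for x, continuous F}.

(* Meant for open U. *)
Definition smooth_on (U : set 'rV[R]_3) (F : 'rV[R]_3 -> R) : Prop :=
  forall k, Ck k U F.

Definition local_extension (f : states R -> R) (p : states R)
    (F : 'rV[R]_3 -> R) : Prop :=
  exists U : set 'rV[R]_3, [/\ open_nbhs (\val p) U, smooth_on U F &
    forall q : states R, U (\val q) -> F (\val q) = f q].

Definition smooth : set (states R -> R) :=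
  [set f | forall p, exists F, local_extension f p F].

(* The partial derivative at p is that of any smooth extension near p; by     *)
(* [local_extension_derive] below the choice is irrelevant, even when p lies  *)
(* on the boundary sphere.                                                    *)
Definition pd (j : 'I_3) (f : states R -> R) (p : states R) : R :=
  'D_(partial R j) (xget (fun=> 0) [set F | local_extension f p F]) (\val p).

(* T(df, dg), with (v (x) w)(df, dg) = v(f) w(g) *)
Definition contract (T : 'rV[R]_3 -> 'M[R]_3) (f g : states R -> R)
    : states R -> R :=
  fun p => \sum_j \sum_k T (\val p) j k * pd j f p * pd k g p.

Definition bracket_oo (f g : states R -> R) : states R -> R :=
  contract (@Lambda_oo R) f g.

Definition product_oo (f g : states R -> R) : states R -> R :=
  contract (@R_oo R) f g + f * g.

Lemma local_extension_derive (f : states R -> R) (p : states R)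
    (F G : 'rV[R]_3 -> R) j :
  local_extension f p F -> local_extension f p G ->
  'D_(partial R j) F (\val p) = 'D_(partial R j) G (\val p).
Proof.
move=> [U [[oU Up] sF eF]] [V [[oV Vp] sG eG]].
set x := \val p in Up Vp *.
have Dx : \sum_i x 0 i ^+ 2 <= 1 by have := valP p; rewrite inE.
have cF : {for x, continuous ('D_(partial R j) F)}.
  by have [_ /(_ j)] := sF 1%N; apply.
have cG : {for x, continuous ('D_(partial R j) G)}.
  by have [_ /(_ j)] := sG 1%N; apply.
apply/eqP; rewrite -subr_eq0; apply/negPn/negP => ne0.
have cH : 'D_(partial R j) F y - 'D_(partial R j) G y @[y --> x] -->
    'D_(partial R j) F x - 'D_(partial R j) G x.
  exact: (cvgB cF cG).
have nH : \forall y \near x, 'D_(partial R j) F y - 'D_(partial R j) G y != 0.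
  by apply: (cH [set u | u != 0]); apply: open_nbhs_nbhs; split => //; exact: open_neq.
have nUV : \forall y \near x,
    [/\ 'D_(partial R j) F y - 'D_(partial R j) G y != 0, U y & V y].
  near=> y; split; near: y => //.
  - exact: open_nbhs_nbhs.
  - exact: open_nbhs_nbhs.
have cs : (fun s : R => s *: x) s @[s --> (1 : R)^'-] --> x.
  apply: cvg_at_left_filter.
  rewrite -{2}[x]scale1r; apply: cvgZr_tmp; exact: cvg_id.
have ns := cs _ nUV.
have [s [s1 [s0 [dne Us Vs]]]] : exists s : R, s < 1 /\ 0 < s /\
   [/\ 'D_(partial R j) F (s *: x) - 'D_(partial R j) G (s *: x) != 0, U (s *: x) & V (s *: x)].
  have l1 := nbhs_left_lt (1 : R).
  have l0 := @nbhs_left_gt R 1 0 ltr01.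
  have [s [[s1 s0] h]] := filter_ex (filterI (filterI l1 l0) ns).
  by exists s.
move/eqP: dne; apply; apply/eqP; rewrite subr_eq0; apply/eqP.
apply: near_eq_derive.
have cq : continuous (fun y : 'rV[R]_3 => \sum_i y 0 i ^+ 2).
  apply: continuous_big => [|i _ y]; first exact: add_continuous.
  apply: (continuous_comp (g := fun r : R => r ^+ 2)).
    exact: coord_continuous.
  exact: exprn_continuous.
have nq : \forall y \near s *: x, \sum_i (y : 'rV[R]_3) 0 i ^+ 2 < 1.
  apply: (cq (s *: x) [set u | u < 1]).
  apply: open_nbhs_nbhs; split; first exact: open_lt.
  have -> : \sum_i (s *: x) 0 i ^+ 2 = s ^+ 2 * \sum_i x 0 i ^+ 2.
    by rewrite mulr_sumr; apply: eq_bigr => i _; rewrite !mxE exprMn.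
  apply: (@le_lt_trans _ _ (s ^+ 2)); first by rewrite ler_piMr // sqr_ge0.
  by rewrite expr_lt1 // ltW.
near=> y.
have Dy : y \in states R by rewrite inE /states /=; apply/ltW; near: y.
have Uy : U y by near: y; exact: open_nbhs_nbhs.
have Vy : V y by near: y; exact: open_nbhs_nbhs.
have := eF (exist _ y Dy) Uy; have := eG (exist _ y Dy) Vy => /= -> ->.
by [].
Unshelve. all: by end_near.
Qed.

Lemma pdE (f : states R -> R) (p : states R) (F : 'rV[R]_3 -> R) j :
  local_extension f p F -> pd j f p = 'D_(partial R j) F (\val p).
Proof.
move=> fF; apply: (local_extension_derive (f := f)) => //.
exact: (xgetPex (fun=> 0) (ex_intro (local_extension f p) F fF)).
Qed.

End Smooth.

Section Products.
Variables (R : realType) (X : Type) (A : set (X -> R)).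

Record bilinear_product (op : (X -> R) -> (X -> R) -> (X -> R)) : Prop := {
  product_closed : forall f g, A f -> A g -> A (op f g) ;
  product_linearl : forall (a : R) f g h, A f -> A g -> A h ->
    op (a *: f + g) h = a *: op f h + op g h ;
  product_linearr : forall (a : R) f g h, A f -> A g -> A h ->
    op h (a *: f + g) = a *: op h f + op h g }.

Record poisson_bracket (br : (X -> R) -> (X -> R) -> (X -> R)) : Prop := {
  poisson_bilinear : bilinear_product br ;
  poisson_antisym : forall f g, A f -> A g -> br f g = - br g f ;
  poisson_leibniz : forall f g h, A f -> A g -> A h ->
    br f (g * h) = br f g * h + g * br f h ;
  poisson_jacobi : forall f g h, A f -> A g -> A h ->
    br f (br g h) + br g (br h f) + br h (br f g) = 0 }.

Record symmetric_product (op : (X -> R) -> (X -> R) -> (X -> R)) : Prop := {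
  symmetric_bilinear : bilinear_product op ;
  symmetric_sym : forall f g, A f -> A g -> op f g = op g f }.

End Products.

(* Main.v *)
(* The field Z_L is linear and diagonal, so its flow scales the coordinates by
   e^-t, e^-t, e^-2t (the only solution: e^(ct) Phi_j(t) has zero derivative),
   and the push-forward acts on tensor entries by the corresponding powers of
   e^-t, whence the limits. On the ball, partial derivatives of smooth functions
   are computed with local extensions; they are commuting derivations, the
   commutation being Schwarz's theorem. Since the bracket x_3 (f_1 g_2 - f_2 g_1)
   differentiates only in directions killing x_3, Jacobi follows formally. *)
Require Import Defs.
From HB Require Import structures.
From mathcomp Require Import all_boot all_order all_algebra.
From mathcomp Require Import all_classical all_reals all_analysis.
From mathcomp Require Import complex.
From mathcomp Require Import ring.

Set Implicit Arguments.
Unset Strict Implicit.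
Unset Printing Implicit Defensive.

Import Order.TTheory GRing.Theory Num.Theory.
Import numFieldNormedType.Exports.

Local Open Scope classical_set_scope.
Local Open Scope ring_scope.

(** * Schwarz's theorem for directional derivatives in a normed space *)

Section MixedDerivatives.
Variables (R : realType) (V : normedModType R).
Implicit Types (f : V -> R) (x y u v : V).

(** Since r v + (s v + x) = (r + s) v + x, the two difference quotients coincide; this brings
    one-variable calculus to directional derivatives. *)
Lemma is_derive_line f x v (s : R) : derivable f (s *: v + x) v ->
  is_derive s 1 (fun r => f (r *: v + x)) ('D_v f (s *: v + x)).
Proof.
have E : (fun h : R => h^-1 *: (((fun r => f (r *: v + x)) \o shift s) (h *: 1)
             - f (s *: v + x))) =
         (fun h => h^-1 *: ((f \o shift (s *: v + x)) (h *: v)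
             - f (s *: v + x))).
  by apply/funext => h /=; rewrite [h%:A]mulr1 scalerDl addrA.
move=> df; apply: DeriveDef; first by rewrite /derivable E.
by rewrite /derive E.
Qed.

Lemma mean_value_line f x v (h : R) : 0 <= h ->
  (forall s, s \in `[0, h] -> derivable f (s *: v + x) v) ->
  exists2 s, s \in `[0, h] & f (h *: v + x) - f x = 'D_v f (s *: v + x) * h.
Proof.
move=> h0 df.
have dg s : s \in `[0, h] ->
    is_derive s (1 : R) (fun r => f (r *: v + x)) ('D_v f (s *: v + x)).
  by move=> /df; exact: is_derive_line.
have dgo s : s \in `]0, h[ ->
    is_derive s (1 : R) (fun r => f (r *: v + x)) ('D_v f (s *: v + x)).
  by move=> sh; apply: dg; exact: subset_itv_oo_cc.
have cg : {within `[0, h], continuous (fun r => f (r *: v + x))}.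
  by apply: derivable_within_continuous => s /dg[].
have [s sh E] := MVT_segment h0 dgo cg.
by exists s => //; move: E; rewrite scale0r add0r subr0.
Qed.

(** The mean value theorem is applied twice: along u to the increment [g] of [f] in direction v,
    then along v to ['D_u f]. *)
Lemma second_difference f x u v (h : R) : 0 <= h ->
  (forall s t, s \in `[0, h] -> t \in `[0, h] ->
    derivable f (s *: u + (t *: v + x)) u /\
    derivable ('D_u f) (t *: v + (s *: u + x)) v) ->
  exists s t, [/\ s \in `[0, h], t \in `[0, h] &
    f (h *: u + (h *: v + x)) - f (h *: u + x) - (f (h *: v + x) - f x)
    = 'D_v ('D_u f) (t *: v + (s *: u + x)) * h ^+ 2].
Proof.
move=> h0 df.
have h0h : 0 \in `[0, h] by rewrite in_itv /= lexx.
have hhh : h \in `[0, h] by rewrite in_itv /= lexx h0.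
pose g := (fun y => f (h *: v + y) - f y).
have dg s : s \in `[0, h] -> is_derive (s *: u + x) u g
    ('D_u f (h *: v + (s *: u + x)) - 'D_u f (s *: u + x)).
  move=> sh; apply: is_deriveB; last first.
    apply: derivableP.
    by have [] := df s 0 sh h0h; rewrite scale0r add0r.
  have [d1 _] := df s h sh hhh; rewrite addrCA in d1.
  have := derivableP d1.
  have E : (fun r : R => r^-1 *: (((fun y => f (h *: v + y)) \o
      shift (s *: u + x)) (r *: u) - f (h *: v + (s *: u + x)))) =
     (fun r => r^-1 *: ((f \o shift (h *: v + (s *: u + x))) (r *: u)
             - f (h *: v + (s *: u + x)))).
    by apply/funext => r /=; rewrite (addrCA (h *: v)).
  move=> [dd1 _]; apply: DeriveDef; first by rewrite /derivable E.
  by rewrite /derive E.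
have [s /dg[]|s sh Es] := @mean_value_line g x u h h0; first by [].
have [_ dgs] := dg s sh.
have [t th|t th Et] := @mean_value_line ('D_u f) (s *: u + x) v h h0.
  by have [] := df s t sh th.
exists s, t; split=> //.
rewrite expr2 mulrA -Et -dgs -Es /g (addrCA (h *: v)).
ring.
Qed.

(* A and B keep the two iterated derivatives apart for unification, which would
   otherwise unfold them down to limits. *)
Lemma mixed_derivatives_eq f (A B : V -> R) x u v :
  'D_v ('D_u f) =1 A -> 'D_u ('D_v f) =1 B ->
  (\forall y \near x, [/\ derivable f y u, derivable f y v,
     derivable ('D_u f) y v & derivable ('D_v f) y u]) ->
  {for x, continuous A} -> {for x, continuous B} -> A x = B x.
Proof.
move=> DA DB df cA cB.
apply/eqP; rewrite -subr_eq0 -normr_eq0 eq_le normr_ge0 andbT.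
apply/ler_addgt0Pl => e e0; rewrite addr0.
have e20 : 0 < e / 2 by rewrite divr_gt0.
have nA : \forall y \near x, `|A x - A y| < e / 2 by move/cvgrPdist_lt : cA; exact.
have nB : \forall y \near x, `|B x - B y| < e / 2 by move/cvgrPdist_lt : cB; exact.
have [d /= d0 Hd] := (nbhs_ballP _ _).1 (filterI df (filterI nA nB)).
(* This [h] keeps the parallelogram spanned by h u and h v at x inside the ball of radius d; the
   added 1 keeps the denominator positive when u and v vanish. *)
pose h := d / 2 / (`|u| + `|v| + 1).
have k0 : 0 < `|u| + `|v| + 1 by rewrite ltr_wpDl ?addr_ge0.
have h0 : 0 < h by rewrite !divr_gt0.
have Hb s t : s \in `[0, h] -> t \in `[0, h] -> ball x d (s *: u + (t *: v + x)).
  rewrite !in_itv /= => /andP[s0 sh] /andP[t0 th].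
  rewrite -ball_normE /= addrA opprD addrCA subrr addr0 normrN.
  apply: (le_lt_trans (ler_normD _ _)); rewrite !normrZ !ger0_norm //.
  apply: (@le_lt_trans _ _ (h * (`|u| + `|v| + 1))).
    rewrite !mulrDr mulr1 -[leLHS]addr0 lerD ?(ltW h0) //.
    by rewrite lerD // ler_wpM2r.
  by rewrite /h divfK ?gt_eqF // ltr_pdivrMr // ltr_pMr // ltr1n.
have [s t sh th|s [t [sh th /[!DA] EA]]] := @second_difference f x u v h (ltW h0).
  have [[dfu _ + _] _] := Hd _ (Hb s t sh th).
  by rewrite {1}(addrCA (s *: u)) => dDf; split.
have [s' t' sh' th'|s' [t' [sh' th' /[!DB] EB]]] :=
    @second_difference f x v u h (ltW h0).
  have [[_ dfv _ dDf] _] := Hd _ (Hb t' s' th' sh').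
  by split; [rewrite (addrCA (s' *: v)); exact: dfv|exact: dDf].
have [_ [+ _]] := Hd _ (Hb s t sh th); rewrite addrCA => nAx.
have [_ [_ nBx]] := Hd _ (Hb t' s' th' sh').
(* Multiplied by h^2, both sides are the same second difference, which is symmetric in u and v. *)
have EAB : A (t *: v + (s *: u + x)) = B (t' *: u + (s' *: v + x)).
  apply: (mulIf (x := h ^+ 2)); first by rewrite expf_neq0 ?gt_eqF.
  by rewrite -EA -EB (addrCA (h *: v)); ring.
(* A x - B x splits at this common value into two differences, each smaller than e / 2. *)
rewrite -(subrKA (A (t *: v + (s *: u + x)))) {2}EAB.
apply: (le_trans (ler_normD _ _)); rewrite [leRHS]splitr ltW // ltrD //.
by rewrite distrC.
Qed.

End MixedDerivatives.

(** * Sums and case analysis over the three coordinate indices *)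

Lemma sum_ord3 (V : nmodType) (F : 'I_3 -> V) : \sum_j F j = F 0 + F 1 + F 2.
Proof.
rewrite !big_ord_recl big_ord0 addr0 addrA.
by congr (F _ + F _ + F _); apply/val_inj.
Qed.

(** Reduces entrywise identities of 3 x 3 matrices to finitely many cases with literal indices. *)
Lemma ord3_ind (P : 'I_3 -> Prop) : P 0 -> P 1 -> P 2 -> forall j, P j.
Proof.
by move=> P0 P1 P2 [[|[|[|//]]] i]; [move: P0|move: P1|move: P2];
  congr (P _); apply/val_inj.
Qed.

(** * Calculus of C^k and smooth functions on R^3 *)

Section SmoothFunctions.
Variable R : realType.
Implicit Types (U V : set 'rV[R]_3) (F G : 'rV[R]_3 -> R).

(** First-order expansions are local: G inherits the expansion of F, and uniqueness of the
    differential identifies the linear parts. *)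
Lemma near_eq_differentiable F G x : (\near x, F x = G x) ->
  differentiable F x -> differentiable G x.
Proof.
move=> FG /diff_locallyP[cF /eqaddoP eF]; apply/diff_locallyP.
have Fx := nbhs_singleton FG.
suff EG : G \o shift x = cst (G x) + 'd F x +o_ (0 : 'rV[R]_3) id.
  by rewrite (diff_unique cF EG).
apply/eqaddoP => _/posnumP[e].
have sFG : \forall y \near (0 : 'rV[R]_3), F (y + x) = G (y + x).
  by move: FG; rewrite (near_shift 0) subr0.
near=> y.
have Ey : F (y + x) = G (y + x) by near: y.
rewrite -[(_ - _) y]/(G (y + x) - (G x + 'd F x y)) -Ey -Fx.
by near: y; exact: (eF e%:num).
Unshelve. all: by end_near. Qed.

Lemma Ck_subset k U V F : V `<=` U -> Ck k U F -> Ck k V F.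
Proof.
move=> VU; elim: k F => [|k IH] F /=; first by move=> cF x /VU; exact: cF.
by move=> [dF DF]; split=> [x /VU|j]; [exact: dF|exact: IH].
Qed.

(** In the product rule F and G also appear undifferentiated, next to derivatives of one class less,
    so their own class has to be lowered. *)
Lemma Ck_pred k U F : Ck k.+1 U F -> Ck k U F.
Proof.
elim: k F => [|k IH] F [dF DF].
  by move=> x Ux; exact/differentiable_continuous/dF.
by split=> // j; exact: IH.
Qed.

(** The sum and product rules for derivatives hold only at points of U, not as equalities of
    functions. As U is open, an equality on U holds near each of its points and so passes to
    derivatives. *)
Lemma eq_Ck k U F G : open U -> (forall x, U x -> F x = G x) ->
  Ck k U F -> Ck k U G.
Proof.
move=> oU; have nU x : U x -> \near x, U x by move=> Ux; exact: open_nbhs_nbhs.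
elim: k F G => [|k IH] F G FG /=.
  move=> cF x Ux; suff : G y @[y --> x] --> G x by [].
  rewrite -FG //; apply: cvg_trans (cF x Ux); apply: (@near_eq_cvg _ _ (nbhs x)).
  by apply: filterS (nU x Ux); exact: FG.
move=> [dF DF]; split=> [x Ux|j].
  apply: near_eq_differentiable (dF x Ux).
  by apply: filterS (nU x Ux); exact: FG.
apply: IH (DF j) => x Ux; apply: near_eq_derive.
by apply: filterS (nU x Ux); exact: FG.
Qed.

Lemma Ck_cst k U (a : R) : Ck k U (cst a).
Proof.
elim: k a => [|k IH] a /=; first by move=> x _; exact: cst_continuous.
split=> [x _|j]; first exact: differentiable_cst.
have -> : 'D_(partial R j) (cst a) = cst 0 by apply/funext => x; exact: derive_cst.
exact: IH.
Qed.

Lemma CkD k U F G : open U -> Ck k U F -> Ck k U G -> Ck k U (F + G).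
Proof.
move=> oU; elim: k F G => [|k IH] F G /=.
  by move=> cF cG x Ux; apply: continuousD; [exact: cF|exact: cG].
move=> [dF DF] [dG DG]; split=> [x Ux|j].
  by apply: differentiableD; [exact: dF|exact: dG].
apply: eq_Ck (IH _ _ (DF j) (DG j)) => // x Ux.
by rewrite deriveD //; apply: diff_derivable; [exact: dF|exact: dG].
Qed.

Lemma CkM k U F G : open U -> Ck k U F -> Ck k U G -> Ck k U (F * G).
Proof.
move=> oU; elim: k F G => [|k IH] F G.
  by move=> cF cG x Ux; apply: continuousM; [exact: cF|exact: cG].
move=> CF CG; have [dF DF] := CF; have [dG DG] := CG; split=> [x Ux|j].
  by apply: differentiableM; [exact: dF|exact: dG].
have := CkD oU (IH _ _ (Ck_pred CF) (DG j)) (IH _ _ (Ck_pred CG) (DF j)).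
apply: eq_Ck => // x Ux.
by rewrite deriveM //; apply: diff_derivable; [exact: dF|exact: dG].
Qed.

Definition coord (l : 'I_3) (x : 'rV[R]_3) : R := x 0 l.

Lemma derive_coord j l x : 'D_(partial R j) (coord l) x = (j == l)%:R.
Proof.
have D : derivable (id : 'rV[R]_3 -> 'rV[R]_3) x (partial R j) by [].
have := derive_mx D; rewrite derive_id => /matrixP /(_ 0 l).
by rewrite !mxE eqxx /= eq_sym => ->.
Qed.

Lemma Ck_coord k U l : Ck k U (coord l).
Proof.
case: k => [|k] /=; first by move=> x _; exact: coord_continuous.
split=> [x _|j]; first exact: differentiable_coord.
have -> : 'D_(partial R j) (coord l) = cst (j == l)%:R.
  by apply/funext => x; exact: derive_coord.
exact: Ck_cst.
Qed.

Lemma smooth_on_derive U F j : smooth_on U F -> smooth_on U ('D_(partial R j) F).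
Proof. by move=> sF k; have [_] := sF k.+1; apply. Qed.

Lemma smooth_on_differentiable U F x : smooth_on U F -> U x -> differentiable F x.
Proof. by move=> /(_ 1%N)[dF _]; exact: dF. Qed.

Lemma smooth_on_derivable U F x v : smooth_on U F -> U x -> derivable F x v.
Proof. by move=> sF Ux; exact/diff_derivable/(smooth_on_differentiable sF). Qed.

Lemma smooth_on_derive_comm U F i j x : open U -> smooth_on U F -> U x ->
  'D_(partial R i) ('D_(partial R j) F) x = 'D_(partial R j) ('D_(partial R i) F) x.
Proof.
move=> oU sF Ux; have sD k := smooth_on_derive k sF.
have nU : \forall y \near x, U y by exact: open_nbhs_nbhs.
have nD : \forall y \near x, [/\ derivable F y (partial R j),
    derivable F y (partial R i),
    derivable ('D_(partial R j) F) y (partial R i) &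
    derivable ('D_(partial R i) F) y (partial R j)].
  apply: filterS nU => y Uy.
  split; [exact: (smooth_on_derivable sF Uy)|exact: (smooth_on_derivable sF Uy)|..].
    exact: (smooth_on_derivable (sD j) Uy).
  exact: (smooth_on_derivable (sD i) Uy).
(* Order 0 of smoothness is continuity, here of the second derivatives. *)
have cji := smooth_on_derive i (sD j) 0%N x Ux.
have cij := smooth_on_derive j (sD i) 0%N x Ux.
exact: (mixed_derivatives_eq (fun=> erefl) (fun=> erefl) nD cji cij).
Qed.

End SmoothFunctions.

(** * The dissipative generator in Bloch coordinates *)

Section QuantumGenerator.
Variable R : realType.
Local Open Scope complex_scope.
Implicit Types (a b c d : R[i]) (x v : 'rV[R]_3).

Lemma add_mx22 a b c d a' b' c' d' :
  mx22 a b c d + mx22 a' b' c' d' = mx22 (a + a') (b + b') (c + c') (d + d').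
Proof. by apply/matrixP => i j; rewrite !mxE; do 2 case: ifP. Qed.

Lemma opp_mx22 a b c d : - mx22 a b c d = mx22 (- a) (- b) (- c) (- d).
Proof. by apply/matrixP => i j; rewrite !mxE; do 2 case: ifP. Qed.

Lemma scale_mx22 k a b c d :
  k *: mx22 a b c d = mx22 (k * a) (k * b) (k * c) (k * d).
Proof. by apply/matrixP => i j; rewrite !mxE; do 2 case: ifP. Qed.

Lemma mul_mx22 a b c d a' b' c' d' :
  mx22 a b c d *m mx22 a' b' c' d' =
  mx22 (a * a' + b * c') (a * b' + b * d') (c * a' + d * c') (c * b' + d * d').
Proof.
apply/matrixP => i j; rewrite !mxE !big_ord_recl big_ord0 !mxE /= addr0.
by do 2 case: ifP.
Qed.

Lemma adj_mx22 a b c d : adjmx (mx22 a b c d) =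
  mx22 (Num.conj a) (Num.conj c) (Num.conj b) (Num.conj d).
Proof. by apply/matrixP => i j; rewrite !mxE; do 2 case: ifP. Qed.

Lemma one_mx22 : 1%:M = mx22 1 0 0 1 :> 'M[R[i]]_2.
Proof.
apply/matrixP => i j; rewrite !mxE.
by case: i => [[|[|//]] ?]; case: j => [[|[|//]] ?].
Qed.

Lemma sum_pauli v : \sum_j (v 0 j)%:C *: pauli R j =
  mx22 (v 0 2)%:C ((v 0 0)%:C - 'i * (v 0 1)%:C)
       ((v 0 0)%:C + 'i * (v 0 1)%:C) (- (v 0 2)%:C).
Proof.
rewrite sum_ord3 /pauli /= !scale_mx22 !add_mx22.
by rewrite complexiE; congr mx22; ring.
Qed.

Lemma adj_Jplus : adjmx (Jplus R) = Jminus R.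
Proof.
by rewrite /Jplus adj_mx22; congr mx22; (exact: conjC0 || exact: conjC1).
Qed.

Lemma adj_Jminus : adjmx (Jminus R) = Jplus R.
Proof.
by rewrite /Jminus adj_mx22; congr mx22; (exact: conjC0 || exact: conjC1).
Qed.

(** [Jplus] and [Jminus] are adjoint to each other and J_- J_+ + J_+ J_- = 1, so L(rho) = J_+ rho
    J_- + J_- rho J_+ - rho. The first two terms swap the diagonal entries of rho and erase the
    others, whence the rates 1, 1, 2. The proof compares the four entries. *)
Lemma associated_field_generator : associated_field (@generator R) (@ZL R).
Proof.
move=> x; rewrite /generator /dissipator adj_Jplus adj_Jminus.
rewrite /Jplus /Jminus /bloch /dbloch !sum_pauli one_mx22.
rewrite !(add_mx22, scale_mx22, mul_mx22, opp_mx22).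
have -> : ZL x 0 0 = - x 0 0 by rewrite !mxE /=; ring.
have -> : ZL x 0 1 = - x 0 1 by rewrite !mxE /=; ring.
have -> : ZL x 0 2 = - (2 * x 0 2) by rewrite !mxE /=; ring.
rewrite !(rmorphN, rmorphM) /= !rmorph_nat.
by congr mx22; field.
Qed.
End QuantumGenerator.

(** * Existence and uniqueness of the flow of [ZL] *)

Section Flow.
Variable R : realType.
Implicit Types (t : R) (x v : 'rV[R]_3) (T : 'rV[R]_3 -> 'M[R]_3).

Definition rate (j : 'I_3) : R := if j == 2 then 2 else 1.

Lemma ZLE x j : ZL x 0 j = - rate j * x 0 j.
Proof.
by move: j; apply: ord3_ind; rewrite !mxE /rate /=; ring.
Qed.

Definition decay t (j : 'I_3) : R := expR (- rate j * t).

(** Written as multiplication by a constant diagonal matrix, so that the Jacobian can be read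
    off. *)
Definition decay_flow t x : 'rV[R]_3 := x *m diag_mx (\row_j decay t j).

Lemma decay_flowE t x j : decay_flow t x 0 j = decay t j * x 0 j.
Proof. by rewrite /decay_flow mul_mx_diag !mxE mulrC. Qed.

Lemma is_derive_expR_scale (c : R) t :
  is_derive t (1 : R) (fun s : R => expR (c * s)) (c * expR (c * t)).
Proof.
have dc : is_derive t (1 : R) (fun s : R => c * s) c.
  by have := is_deriveZ c (is_derive_id t 1); rewrite [_%:A]mulr1.
have := is_derive1_comp (is_derive_expR (c * t)) dc.
by rewrite mulrC.
Qed.

Lemma is_flow_decay_flow : is_flow (@ZL R) decay_flow.
Proof.
split=> [x|t x].
  by apply/rowP => j; rewrite decay_flowE /decay mulr0 expR0 mul1r.
have dE i j : is_derive t (1 : R) (fun s => decay_flow s x i j)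
    (- rate j * decay t j * x i j).
  rewrite ord1; under eq_fun do rewrite decay_flowE mulrC.
  have := is_deriveZ (x 0 j) (is_derive_expR_scale (- rate j) t).
  by rewrite -[x 0 j *: _]/(x 0 j * _) mulrC.
have dM : derivable (decay_flow ^~ x) t 1.
  by apply/derivable_mxP => i j; case: (dE i j).
apply: DeriveDef => //; rewrite derive_mx //; apply/rowP => j.
by rewrite mxE ZLE decay_flowE mulrA; case: (dE 0 j).
Qed.

(** [is_flow] says nothing about regularity in x. Uniqueness, shown coordinatewise for fixed x,
    supplies the differentiability in x on which the push-forward relies. *)
Lemma is_flow_unique Phi : is_flow (@ZL R) Phi -> Phi = decay_flow.
Proof.
move=> [Phi0 dPhi]; apply/funext => t; apply/funext => x; apply/rowP => j.
rewrite decay_flowE.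
pose g s := expR (rate j * s) * Phi s x 0 j.
have dP s : is_derive s (1 : R) (fun s => Phi s x 0 j) (- rate j * Phi s x 0 j).
  have [dM eM] := dPhi s x; move/derivable_mxP : (dM) => /(_ 0 j) dM0.
  apply: DeriveDef => //; rewrite -ZLE -eM.
  by rewrite derive_mx // mxE.
have dg s : is_derive s (1 : R) g 0.
  have h1 := is_derive_expR_scale (rate j) s; have h2 := dP s.
  have := is_deriveM h1 h2; congr is_derive.
  rewrite -![_ *: _]/(_ * _); ring.
have := is_derive_0_is_cst t 0 dg; rewrite /g mulr0 expR0 mul1r Phi0 => <-.
by rewrite mulrA /decay -expRD mulNr addrC subrr expR0 mul1r.
Qed.

(** * Push-forward of tensor fields by the flow *)

Lemma jacobian_mulmx (A : 'M[R]_3) x : 'J (mulmx^~ A : 'rV[R]_3 -> 'rV[R]_3) x = A.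
Proof.
(* A continuous linear map is its own differential; continuity is seen by writing z A as the sum of
   the z_k times the rows of A. *)
have cA : continuous (mulmxr A : 'rV[R]_3 -> 'rV[R]_3).
  move=> y; apply: differentiable_continuous.
  have -> : (mulmxr A : 'rV[R]_3 -> 'rV[R]_3) =
      (\sum_(k < 3) (fun z : 'rV[R]_3 => z 0 k *: row k A)).
    by apply/funext => z; rewrite /= mulmx_sum_row fct_sumE.
  apply: differentiable_sum => k; apply: differentiableZl.
  exact: differentiable_coord.
apply/matrixP => i j; rewrite /jacobian mxE.
have -> : (mulmx^~ A : 'rV[R]_3 -> 'rV[R]_3) = mulmxr A by [].
by rewrite diff_lin // /= -rowE mxE.
Qed.

(** As t is arbitrary, the flow at time -t is a two-sided inverse of the flow at time t, which
    [flow_push] presupposes. *)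
Lemma decay_flowK t : cancel (decay_flow (- t)) (decay_flow t).
Proof.
move=> x; apply/rowP => j; rewrite !decay_flowE mulrA /decay -expRD.
by rewrite mulrN subrr expR0 mul1r.
Qed.

Lemma jacobian_decay_flow t x :
  'J (decay_flow t) x = diag_mx (\row_j decay t j).
Proof. exact: jacobian_mulmx. Qed.

Lemma flow_push_decayE t T x j k : flow_push decay_flow t T x j k =
  decay t j * decay t k * T (decay_flow (- t) x) j k.
Proof.
rewrite /flow_push /Defs.pushforward.
rewrite jacobian_decay_flow tr_diag_mx.
by rewrite mul_mx_diag mul_diag_mx !mxE; ring.
Qed.

Lemma tens_partial (j k : 'I_3) :
  tens (partial R j) (partial R k) = delta_mx j k.
Proof. by rewrite /tens /partial trmx_delta mul_delta_mx. Qed.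

Lemma sum_tens_partial (c : 'I_3 -> 'I_3 -> R) :
  \sum_j \sum_k c j k *: tens (partial R j) (partial R k) = \matrix_(j, k) c j k.
Proof.
rewrite [RHS]matrix_sum_delta; apply: eq_bigr => j _; apply: eq_bigr => k _.
by rewrite tens_partial mxE.
Qed.

Lemma sum_wedge_partial (c : 'I_3 -> 'I_3 -> R) :
  \sum_j \sum_k c j k *: wedge (partial R j) (partial R k) =
  \matrix_(j, k) (c j k - c k j).
Proof.
have -> : \matrix_(j, k) (c j k - c k j) =
    \matrix_(j, k) c j k - \matrix_(k, j) c j k.
  by apply/matrixP => j k; rewrite !mxE.
rewrite -!sum_tens_partial [X in _ - X]exchange_big -sumrB.
by apply: eq_bigr => j _; rewrite -sumrB; apply: eq_bigr => k _; rewrite scalerBr.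
Qed.

Lemma sum_Lambda_oo x (a b : 'I_3 -> R) :
  \sum_j \sum_k Lambda_oo x j k * a j * b k = x 0 2 * (a 0 * b 1 - a 1 * b 0).
Proof.
rewrite /Lambda_oo /wedge !tens_partial !sum_ord3 !mxE /=; ring.
Qed.

(** [R_oo] is minus the tensor square of the Euler field sum_j x_j d_j, so its contraction
    factors. *)
Lemma sum_R_oo x (a b : 'I_3 -> R) : \sum_j \sum_k R_oo x j k * a j * b k =
  - ((\sum_j x 0 j * a j) * (\sum_j x 0 j * b j)).
Proof.
rewrite mulr_suml -sumrN; apply: eq_bigr => j _.
rewrite mulr_sumr -sumrN; apply: eq_bigr => k _.
by rewrite /R_oo sum_tens_partial !mxE; ring.
Qed.

Lemma R0E x j k : R0 x j k = (j == k)%:R - x 0 j * x 0 k.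
Proof.
rewrite /R0 sum_tens_partial !mxE; congr (_ - _).
under eq_bigr do rewrite tens_partial.
by rewrite -mx1_sum_delta mxE.
Qed.

Lemma expRN2 t : expR (- 2 * t) = expR (- t) ^+ 2.
Proof. by rewrite -expRM_natl; congr expR; ring. Qed.

Lemma expRN4 t : expR (- 4 * t) = expR (- t) ^+ 4.
Proof. by rewrite -expRM_natl; congr expR; ring. Qed.

Lemma decayE t j : decay t j = if j == 2 then expR (- t) ^+ 2 else expR (- t).
Proof.
by rewrite /decay /rate; case: ifP => _; [exact: expRN2|rewrite mulN1r].
Qed.

(** The coefficient x_j x_k, taken at the backward flow, gains the inverse of the Jacobian factors,
    so the quadratic part is invariant; only the constant part decays. *)
Lemma flow_push_R0 t x : flow_push decay_flow t (@R0 R) x = R_t t x.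
Proof.
apply/matrixP => j k; rewrite flow_push_decayE R0E !decay_flowE.
rewrite /R_t sum_tens_partial !tens_partial !mxE expRN2 expRN4 !decayE opprK.
(* With u = e^(-t) nonzero, every exponential is an integer power of u and each of the nine entries
   is a rational identity. *)
have -> : expR t = (expR (- t))^-1 by rewrite expRN invrK.
have : expR (- t) != 0 by rewrite gt_eqF ?expR_gt0.
move: (expR (- t)) => u u0.
by move: j k; apply: ord3_ind; apply: ord3_ind; rewrite /=; field.
Qed.

(** [levi_civita] is antisymmetric in j and k, so the wedge doubles each coefficient and the factor
    1/2 undoes this. *)
Lemma Lambda0E x j k :
  Lambda0 x j k = \sum_l levi_civita R j k l * x 0 l.
Proof.
rewrite /Lambda0.
under eq_bigr => a _ do under eq_bigr => b _ do rewrite -scaler_suml.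
rewrite sum_wedge_partial !mxE -sumrB mulr_sumr; apply: eq_bigr => l _.
by move: j k l; do 3 apply: ord3_ind; rewrite /levi_civita /=; field.
Qed.

(** The entry in directions j, k carries the third coordinate x_l, hence the factor e^(-(r_j + r_k -
    r_l) t) with r the rates: the exponent is 0 for the directions 1, 2 and -2t for the other two
    pairs. *)
Lemma flow_push_Lambda0 t x : flow_push decay_flow t (@Lambda0 R) x = Lambda_t t x.
Proof.
apply/matrixP => j k; rewrite flow_push_decayE Lambda0E sum_ord3 !decay_flowE.
rewrite /Lambda_t /wedge !tens_partial !mxE expRN2 !decayE opprK.
have -> : expR t = (expR (- t))^-1 by rewrite expRN invrK.
have : expR (- t) != 0 by rewrite gt_eqF ?expR_gt0.
move: (expR (- t)) => u u0.
by move: j k; apply: ord3_ind; apply: ord3_ind; rewrite /levi_civita /=; field.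
Qed.

(** * Limits as t tends to infinity *)

Lemma cvg_expRN (c : R) : 0 < c -> expR (- c * t) @[t --> +oo] --> (0 : R).
Proof.
move=> c0; under eq_fun do rewrite mulNr.
apply: (cvg_comp (fun t => c * t) (fun t => expR (- t))) (@cvgr_expR R).
exact: gt0_cvgMry.
Qed.

Lemma cvg_Lambda_t x j k : Lambda_t t x j k @[t --> +oo] --> Lambda_oo x j k.
Proof.
(* The terms with factor 0 exhibit the limit in the same shape as the sum, so that limits can be
   taken term by term. *)
have -> : Lambda_oo x j k = Lambda_oo x j k
    + 0 * (x 0 0 * wedge (partial R 1) (partial R 2) j k)
    + 0 * (x 0 1 * wedge (partial R 2) (partial R 0) j k) by ring.
have -> : (fun t => Lambda_t t x j k) = (fun t => Lambda_oo x j k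
    + expR (- 2 * t) * (x 0 0 * wedge (partial R 1) (partial R 2) j k)
    + expR (- 2 * t) * (x 0 1 * wedge (partial R 2) (partial R 0) j k)).
  by apply/funext => t; rewrite /Lambda_t 2!mxE [X in _ + X]mxE !mulrA
    [X in _ + X + _]mxE.
have c2 := cvg_expRN (ltr0n R 2).
apply: cvgD; last exact: cvgMr_tmp.
by apply: cvgD; [exact: cvg_cst|exact: cvgMr_tmp].
Qed.

Lemma cvg_R_t x j k : R_t t x j k @[t --> +oo] --> R_oo x j k.
Proof.
pose T1 := tens (partial R 0) (partial R 0) + tens (partial R 1) (partial R 1).
pose T2 := tens (partial R 2) (partial R 2).
have -> : R_oo x j k = 0 * T1 j k + 0 * T2 j k + R_oo x j k by ring.
have -> : (fun t => R_t t x j k) = (fun t =>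
    expR (- 2 * t) * T1 j k + expR (- 4 * t) * T2 j k + R_oo x j k).
  apply/funext => t; rewrite /R_t /R_oo 2!mxE; congr (_ + _ + _).
    by rewrite mxE.
  by rewrite mxE.
have c2 := cvg_expRN (ltr0n R 2); have c4 := cvg_expRN (ltr0n R 4).
apply: cvgD; last exact: cvg_cst.
by apply: cvgD; exact: cvgMr_tmp.
Qed.

End Flow.

(** * Poisson and symmetric products built from abstract commuting derivations *)

Section CoordinateCalculus.
Variables (R : realType) (X : Type) (S : set (X -> R)).
Variables (d : 'I_3 -> (X -> R) -> (X -> R)) (z : 'I_3 -> X -> R).

(* Partial derivatives are handled abstractly: on the concrete ones, ring
   compares distinct derivatives by unfolding them down to limits. *)
Record coord_calculus : Prop := {
  calculus_cst : forall a, S (cst a) ;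
  calculusD : forall f g, S f -> S g -> S (f + g) ;
  calculusM : forall f g, S f -> S g -> S (f * g) ;
  calculus_coord : forall l, S (z l) ;
  calculus_d : forall j f, S f -> S (d j f) ;
  d_cst : forall a j, d j (cst a) = 0 ;
  dD : forall j f g, S f -> S g -> d j (f + g) = d j f + d j g ;
  dM : forall j f g, S f -> S g -> d j (f * g) = f * d j g + g * d j f ;
  d_comm : forall i j f, S f -> d i (d j f) = d j (d i f) ;
  d_coord : forall j l, d j (z l) = (j == l)%:R }.

Definition planar_bracket (f g : X -> R) : X -> R :=
  z 2 * (d 0 f * d 1 g - d 1 f * d 0 g).

Definition euler (f : X -> R) : X -> R := \sum_j z j * d j f.

Definition euler_product (f g : X -> R) : X -> R := f * g - euler f * euler g.

Hypothesis calc : coord_calculus.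
Implicit Types f g h : X -> R.

(** Scalars become constant functions, so that [ring] can work in the ring of functions. *)
Lemma scale_fun_cst (a : R) f : a *: f = cst a * f.
Proof. by []. Qed.

Lemma opp_fun_cst f : - f = cst (-1) * f.
Proof. by apply/funext => q; rewrite -[RHS]/(-1 * f q) mulN1r. Qed.

Lemma calculusZ (a : R) f : S f -> S (a *: f).
Proof. by move=> sf; apply: calculusM => //; exact: calculus_cst. Qed.

Lemma calculusN f : S f -> S (- f).
Proof. by move=> sf; rewrite opp_fun_cst; exact: calculusZ. Qed.

Lemma dZ j (a : R) f : S f -> d j (a *: f) = a *: d j f.
Proof.
move=> sf; rewrite !scale_fun_cst dM //; last exact: calculus_cst.
by rewrite d_cst // mulr0 addr0.
Qed.

Lemma dN j f : S f -> d j (- f) = - d j f.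
Proof. by move=> sf; rewrite opp_fun_cst [LHS]dZ // [RHS]opp_fun_cst. Qed.

Lemma d_lin j (a : R) f g : S f -> S g -> d j (a *: f + g) = a *: d j f + d j g.
Proof. by move=> sf sg; rewrite dD ?dZ //; exact: calculusZ. Qed.

Lemma calculus_planar_bracket f g : S f -> S g -> S (planar_bracket f g).
Proof.
move=> sf sg; apply: calculusM => //; first exact: calculus_coord.
by apply: calculusD => //; last apply: calculusN; apply: calculusM => //;
  exact: calculus_d.
Qed.

(** For such j, [d j] kills the factor [z 2] and commutes with [d 0] and [d 1], so it is a
    derivation of the bracket. *)
Lemma d_planar_bracket j f g : j != 2 -> S f -> S g ->
  d j (planar_bracket f g) = planar_bracket (d j f) g + planar_bracket f (d j g).
Proof.
move=> j2 sf sg; rewrite /planar_bracket.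
have sDf i : S (d i f) by exact: calculus_d.
have sDg i : S (d i g) by exact: calculus_d.
have sM i k : S (d i f * d k g) by exact: calculusM.
rewrite dM //; [|exact: calculus_coord|by apply: calculusD => //; exact: calculusN].
rewrite d_coord // (negbTE j2) mulr0n dD //; last exact: calculusN.
rewrite dN // !dM //.
rewrite !(d_comm calc j 0) // !(d_comm calc j 1) //.
ring.
Qed.

Lemma poisson_planar_bracket : poisson_bracket S planar_bracket.
Proof.
split.
- split=> [|a f g h sf sg sh|a f g h sf sg sh]; first exact: calculus_planar_bracket.
    by rewrite /planar_bracket !d_lin // !scale_fun_cst; ring.
  by rewrite /planar_bracket !d_lin // !scale_fun_cst; ring.
- by move=> f g _ _; rewrite /planar_bracket; ring.
- by move=> f g h _ sg sh; rewrite /planar_bracket !dM //; ring.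
- move=> f g h sf sg sh.
  (* The outer bracket differentiates the inner one only by [d 0] and [d 1], to which
     [d_planar_bracket] applies. *)
  have E f1 f2 f3 : S f2 -> S f3 -> planar_bracket f1 (planar_bracket f2 f3) =
      z 2 * (d 0 f1 * (planar_bracket (d 1 f2) f3 + planar_bracket f2 (d 1 f3))
     - d 1 f1 * (planar_bracket (d 0 f2) f3 + planar_bracket f2 (d 0 f3))).
    by move=> s2 s3; rewrite {1}/planar_bracket !d_planar_bracket.
  (* Once mixed derivatives are put in a single order, the cyclic sum is a polynomial identity. *)
  rewrite !E // /planar_bracket !(d_comm calc 1 0) //.
  ring.
Qed.

Lemma euler_lin (a : R) f g : S f -> S g ->
  euler (a *: f + g) = a *: euler f + euler g.
Proof.
move=> sf sg; rewrite /euler scaler_sumr -big_split; apply: eq_bigr => j _ /=.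
by rewrite d_lin // !scale_fun_cst; ring.
Qed.

Lemma calculus_euler f : S f -> S (euler f).
Proof.
move=> sf; rewrite /euler sum_ord3.
have sz j : S (z j * d j f).
  by apply: calculusM => //; [exact: calculus_coord|exact: calculus_d].
by do 2?apply: calculusD.
Qed.

Lemma symmetric_euler_product : symmetric_product S euler_product.
Proof.
split; last by move=> f g _ _; rewrite /euler_product; ring.
split=> [f g sf sg|a f g h sf sg sh|a f g h sf sg sh]; rewrite /euler_product.
- apply: calculusD => //; first exact: calculusM.
  by apply: calculusN; apply: calculusM => //; exact: calculus_euler.
- by rewrite euler_lin // !scale_fun_cst; ring.
- by rewrite euler_lin // !scale_fun_cst; ring.
Qed.

End CoordinateCalculus.

(** * Smooth functions on the closed ball *)

Section StateFunctions.
Variable R : realType.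
Implicit Types (f g h : states R -> R) (p q : states R) (F G : 'rV[R]_3 -> R).

(** Unlike in [local_extension], the open set is named and no base point is fixed: one F serves at
    all states in U, so that derivatives can be iterated. *)
Definition extends (U : set 'rV[R]_3) F f :=
  [/\ open U, smooth_on U F & forall q, U (\val q) -> F (\val q) = f q].

Lemma extends_local U F f q : extends U F f -> U (\val q) -> local_extension f q F.
Proof. by move=> [oU sF eF] Uq; exists U; split. Qed.

Lemma extends_pd U F f j q : extends U F f -> U (\val q) ->
  pd j f q = 'D_(partial R j) F (\val q).
Proof. by move=> eF Uq; exact/pdE/(extends_local eF). Qed.

Lemma extends_subset U V F f : open V -> V `<=` U -> extends U F f -> extends V F f.
Proof.
move=> oV VU [_ sF eF]; split=> // [k|q /VU]; last exact: eF.
exact: Ck_subset (sF k).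
Qed.

Lemma smoothP f : smooth f <-> forall p, exists U F, U (\val p) /\ extends U F f.
Proof.
split=> sf p.
  by have [F [U [[oU Up] sF eF]]] := sf p; exists U, F.
by have [U [F [Up eF]]] := sf p; exists F; exact: (extends_local eF).
Qed.

Lemma smooth_extends2 f g p : smooth f -> smooth g ->
  exists U F G, [/\ U (\val p), extends U F f & extends U G g].
Proof.
move=> /smoothP/(_ p)[U [F [Up eF]]] /smoothP/(_ p)[V [G [Vp eG]]].
exists (U `&` V), F, G; have oUV : open (U `&` V).
  by apply: openI; [case: eF|case: eG].
by split=> //; [apply: extends_subset eF|apply: extends_subset eG] => // q [].
Qed.

Lemma extendsD U F G f g : extends U F f -> extends U G g ->
  extends U (F + G) (f + g).
Proof.
move=> [oU sF eF] [_ sG eG]; split=> // [k|q Uq]; first exact: CkD.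
by rewrite -[LHS]/(F (\val q) + G (\val q)) eF // eG.
Qed.

Lemma extendsM U F G f g : extends U F f -> extends U G g ->
  extends U (F * G) (f * g).
Proof.
move=> [oU sF eF] [_ sG eG]; split=> // [k|q Uq]; first exact: CkM.
by rewrite -[LHS]/(F (\val q) * G (\val q)) eF // eG.
Qed.

Lemma extends_cst U (a : R) : open U -> extends U (cst a) (cst a).
Proof. by move=> oU; split=> // k; exact: Ck_cst. Qed.

Definition state_coord l : states R -> R := fun q => \val q 0 l.

Lemma extends_coord U l : open U -> extends U (@coord R l) (state_coord l).
Proof. by move=> oU; split=> // k; exact: Ck_coord. Qed.

(** As [pd] does not depend on the chosen extension, F computes it at every state in U at once,
    boundary points included. *)
Lemma extends_derive U F f j : extends U F f ->
  extends U ('D_(partial R j) F) (pd j f).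
Proof.
move=> eF; have [oU sF _] := eF; split=> // [|q Uq]; first exact: smooth_on_derive.
by rewrite (extends_pd j eF).
Qed.

Lemma smooth_cst (a : R) : smooth (cst a : states R -> R).
Proof.
by apply/smoothP => p; exists setT, (cst a); split=> //; apply: extends_cst; exact: openT.
Qed.

Lemma smooth_coord l : smooth (state_coord l).
Proof.
by apply/smoothP => p; exists setT, (@coord R l); split=> //;
  apply: extends_coord; exact: openT.
Qed.

Lemma smoothD f g : smooth f -> smooth g -> smooth (f + g).
Proof.
move=> sf sg; apply/smoothP => p.
have [U [F [G [Up eF eG]]]] := smooth_extends2 p sf sg.
by exists U, (F + G); split=> //; exact: extendsD.
Qed.

Lemma smoothM f g : smooth f -> smooth g -> smooth (f * g).
Proof.
move=> sf sg; apply/smoothP => p.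
have [U [F [G [Up eF eG]]]] := smooth_extends2 p sf sg.
by exists U, (F * G); split=> //; exact: extendsM.
Qed.

Lemma smooth_pd j f : smooth f -> smooth (pd j f).
Proof.
move=> /smoothP sf; apply/smoothP => p; have [U [F [Up eF]]] := sf p.
by exists U, ('D_(partial R j) F); split=> //; exact: extends_derive.
Qed.

Lemma pd_cst (a : R) j : pd j (cst a) = 0.
Proof.
apply/funext => p; rewrite (extends_pd j (extends_cst a openT)) //.
exact: derive_cst.
Qed.

Lemma pd_coord j l p : pd j (state_coord l) p = (j == l)%:R.
Proof. by rewrite (extends_pd j (extends_coord l openT)) // derive_coord. Qed.

Lemma pdD j f g : smooth f -> smooth g -> pd j (f + g) = pd j f + pd j g.
Proof.
move=> sf sg; apply/funext => p.
have [U [F [G [Up eF eG]]]] := smooth_extends2 p sf sg.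
rewrite (extends_pd j (extendsD eF eG)) //.
have [_ sF _] := eF; have [_ sG _] := eG.
rewrite deriveD; [|exact: smooth_on_derivable Up..].
by rewrite -(extends_pd j eF) // -(extends_pd j eG).
Qed.

Lemma pdM j f g : smooth f -> smooth g -> pd j (f * g) = f * pd j g + g * pd j f.
Proof.
move=> sf sg; apply/funext => p.
have [U [F [G [Up eF eG]]]] := smooth_extends2 p sf sg.
rewrite (extends_pd j (extendsM eF eG)) //.
have [_ sF vF] := eF; have [_ sG vG] := eG.
rewrite deriveM; [|exact: smooth_on_derivable Up..].
by rewrite -(extends_pd j eF) // -(extends_pd j eG) // vF // vG.
Qed.

(** Both orders are computed from one extension F on an open set of R^3, where Schwarz's theorem
    applies even at boundary states. *)
Lemma pd_comm i j f : smooth f -> pd i (pd j f) = pd j (pd i f).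
Proof.
move=> /smoothP sf; apply/funext => p; have [U [F [Up eF]]] := sf p.
have Eij := extends_pd i (extends_derive j eF) Up.
have Eji := extends_pd j (extends_derive i eF) Up.
have [oU sF _] := eF.
exact: etrans Eij (etrans (smooth_on_derive_comm i j oU sF Up) (esym Eji)).
Qed.

Lemma bracket_ooE : bracket_oo (R := R) = planar_bracket (@pd R) state_coord.
Proof.
by apply/funext => f; apply/funext => g; apply/funext => p; exact: sum_Lambda_oo.
Qed.

Lemma product_ooE : product_oo (R := R) = euler_product (@pd R) state_coord.
Proof.
apply/funext => f; apply/funext => g; apply/funext => p.
have E h : euler (@pd R) state_coord h p = \sum_j \val p 0 j * pd j h p.
  by rewrite /euler fct_sumE.
rewrite -[LHS]/(Defs.contract (@R_oo R) f g p + f p * g p).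
rewrite -[RHS]/(f p * g p - euler (@pd R) state_coord f p
  * euler (@pd R) state_coord g p).
by rewrite !E addrC; congr (_ + _); exact: sum_R_oo.
Qed.

Lemma pd_is_coord_calculus : coord_calculus (@smooth R) (@pd R) state_coord.
Proof.
split; [exact: smooth_cst|exact: smoothD|exact: smoothM|exact: smooth_coord|
  exact: smooth_pd|exact: pd_cst|exact: pdD|exact: pdM|exact: pd_comm|].
(* The right-hand side is a numeral in the ring of functions; deciding j = l makes it 0 or 1, whose
   value at p is clear. *)
by move=> j l; apply/funext => p; rewrite pd_coord; case: eqP.
Qed.

Lemma poisson_bracket_oo : poisson_bracket (@smooth R) (@bracket_oo R).
Proof. rewrite bracket_ooE; exact: poisson_planar_bracket pd_is_coord_calculus. Qed.

Lemma symmetric_product_oo : symmetric_product (@smooth R) (@product_oo R).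
Proof. rewrite product_ooE; exact: symmetric_euler_product pd_is_coord_calculus. Qed.

End StateFunctions.
Theorem theorem5p5 (R : realType) :
  associated_field (@generator R) (@ZL R) /\
  (exists Phi, is_flow (@ZL R) Phi) /\
  (forall Phi, is_flow (@ZL R) Phi ->
    (forall t, cancel (Phi (- t)) (Phi t)) /\
    (forall t x, flow_push Phi t (@Lambda0 R) x = Lambda_t t x) /\
    (forall t x, flow_push Phi t (@R0 R) x = R_t t x) /\
    (forall x j k, flow_push Phi t (@Lambda0 R) x j k @[t --> +oo]
                     --> Lambda_oo x j k) /\
    (forall x j k, flow_push Phi t (@R0 R) x j k @[t --> +oo]
                     --> R_oo x j k)) /\
  poisson_bracket (@smooth R) (@bracket_oo R) /\
  symmetric_product (@smooth R) (@product_oo R).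
Proof.
split; first exact: associated_field_generator.
split; first by exists (@decay_flow R); exact: is_flow_decay_flow.
split; last by split; [exact: poisson_bracket_oo|exact: symmetric_product_oo].
(* Uniqueness replaces the arbitrary flow by the explicit one. *)
move=> Phi /is_flow_unique ->.
split; first exact: decay_flowK.
split; first exact: flow_push_Lambda0.
split; first exact: flow_push_R0.
split=> x j k.
  by under eq_fun do rewrite flow_push_Lambda0; exact: cvg_Lambda_t.
by under eq_fun do rewrite flow_push_R0; exact: cvg_R_t.
Qed.
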